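(* Let $G\le\mathrm{Sym}(\Gamma)$ and $H\le\mathrm{Sym}(\Delta)$ be transitive permutation groups on finite sets $\Gamma$ and $\Delta$, and let $G\times H$ act componentwise on $\Gamma\times\Delta$. If both $G$ and $H$ are primitive, then $G\times H$ is pre-primitive.
   Context: The componentwise action of $G\times H$ on $\Gamma\times\Delta$ is $(\gamma,\delta)(g,h)=(\gamma g,\delta h)$. A partition of $\Omega$ is $G$-invariant if every $g\in G$ maps each part onto a part. A transitive permutation group on $\Omega$ is primitive if its only invariant partitions are the partition into singletons and the partition with a single part. The orbit partition of a subgroup is the partition of $\Omega$ into its orbits. A transitive permutation group $G$ on a finite set $\Omega$ is pre-primitive if every $G$-invariant partition of $\Omega$ is the orbit partition of some subgroup of $G$. *)

(* Defs.v *)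
From mathcomp Require Import all_boot all_fingroup all_solvable.

Set Implicit Arguments.
Unset Strict Implicit.
Unset Printing Implicit Defensive.

Import GroupScope.

Section PairAction.

Variables (aT1 aT2 : finGroupType) (T1 T2 : finType).
Variables (to1 : {action aT1 &-> T1}) (to2 : {action aT2 &-> T2}).

Definition pair_act (u : T1 * T2) (a : aT1 * aT2) : T1 * T2 :=
  (to1 u.1 a.1, to2 u.2 a.2).

Fact pair_act1 : pair_act^~ 1 =1 id.
Proof. by case=> x y; rewrite /pair_act /= !act1. Qed.

Fact pair_actM u : act_morph pair_act u.
Proof. by case: u => x y [a b] [c d]; rewrite /pair_act /= !actM. Qed.

Definition pair_action : {action (aT1 * aT2) &-> (T1 * T2)} :=
  TotalAction pair_act1 pair_actM.

End PairAction.

Section Preprimitive.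

Variables (aT : finGroupType) (T : finType).
Implicit Types (A : {group aT}) (S : {set T}) (to : {action aT &-> T}).
Implicit Types Q : {set {set T}}.

Definition invariant_partition A S to Q :=
  partition Q S /\ [acts A, on Q | to^*].

Definition orbit_partition A S to : {set {set T}} := orbit to A @: S.

Definition preprimitive A S to :=
  [transitive A, on S | to]
  /\ forall Q, invariant_partition A S to Q ->
       exists2 K : {group aT}, K \subset A & Q = orbit_partition K S to.

(* The library defines primitivity by excluding invariant partitions with
   1 < #|Q| < #|S|; this is the formulation with the two trivial partitions. *)
Lemma primitive_trivial_partitions A S to :
  [primitive A, on S | to] <->
  [transitive A, on S | to]
  /\ forall Q, invariant_partition A S to Q ->
       Q = [set [set x] | x in S] \/ Q = [set S].
Proof.
have card1 : #|[set [set x] | x in S]| = #|S| by rewrite card_imset //; apply: set1_inj.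
split.
  case/andP=> trA nQ; split=> // Q [pQ aQ].
  have [x Sx _] := imsetP trA; have S0 : 0 < #|S| by apply/card_gt0P; exists x.
  have n0 B : B \in Q -> 0 < #|B|.
    move=> QB; rewrite card_gt0; apply/eqP=> B0.
    by case/and3P: pQ => _ _; rewrite -B0 QB.
  move/existsPn/(_ Q): nQ; rewrite /imprimitivity_system pQ aQ /=.
  rewrite negb_and -!leqNgt => /orP[Q1 | QS].
    right; have Q1' : #|Q| == 1%N.
      rewrite eqn_leq Q1 card_gt0; apply: contraTneq S0 => Q0.
      by rewrite (card_partition pQ) Q0 big_set0.
    have/cards1P[B defQ] := Q1'.
    by have := cover_partition pQ; rewrite defQ /cover big_set1 => ->.
  left; have eqS : \sum_(B in Q) #|B| = \sum_(B in Q) 1%N.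
    apply/eqP; rewrite eqn_leq sum1_card -(card_partition pQ) QS /=.
    by rewrite (card_partition pQ) -sum1_card leq_sum // => B /n0.
  have Q1 B : B \in Q -> #|B| = 1%N.
    have/leqif_sum := fun (B : {set T}) (QB : B \in Q) =>
      leqif_eq (n0 B QB).
    by case=> _; rewrite -eqS eqxx => /esym/forall_inP h /h/eqP/esym.
  have sQ : Q \subset [set [set x] | x in S].
    apply/subsetP=> B QB; have/eqP/cards1P[y defB] := Q1 B QB.
    apply/imsetP; exists y => //; rewrite -(cover_partition pQ).
    by apply/bigcupP; exists B; rewrite // defB set11.
  by apply/eqP; rewrite eqEcard sQ card1.
case=> trA h; apply/andP; split=> //; apply/existsPn=> Q; apply/negP.
case/and3P=> pQ aQ; case: (h Q (conj pQ aQ)) => ->; last by rewrite cards1.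
by rewrite card1 ltnn andbF.
Qed.

End Preprimitive.

(* Main.v *)
Require Import Defs.
From mathcomp Require Import all_boot all_fingroup all_solvable.

Import GroupScope.

Set Implicit Arguments.
Unset Strict Implicit.
Unset Printing Implicit Defensive.

(** Let [A] be the group [G x H], fix a point [(x0, y0)] and let [M], [N] be the
    stabilisers of [x0] in [G] and of [y0] in [H], so that [M x N] is the
    stabiliser of [(x0, y0)] in [A]. Primitivity says that [M] is maximal in [G]
    or equal to it, and likewise for [N] in [H]. If [B] is the part of an
    invariant partition that contains [(x0, y0)], then [B] is an orbit of its
    setwise stabiliser [S], and [M x N <= S <= A].

    A normal subgroup [K] of [A] has all its orbits conjugate under [A], so as
    soon as [B] is one of them the partition is the orbit partition of [K]
    ([normal_orbit_partition]). Since [M x N] fixes [(x0, y0)], it is enough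
    to write [S = (M x N) K] with [K] normal in [A]; this is a question about
    subgroups of a direct product ([dprod_normal_supplement]). By maximality
    [S] meets [G] in [M] or [G], and [H] in [N] or [H]:
    - if [S] contains one of the factors, then [K] can be that factor, or [A];
    - otherwise [S] meets [G] in [M] and [H] in [N]. By Goursat's argument
      ([dprod_subgroup_split]) either [S = M x N], and [K = 1] will do, or [M]
      is normal in [G] and [N] is normal in [H].
    In that last case a normal point stabiliser is trivial, [G] and [H] being
    faithful, so that [G] and [H] have no proper nontrivial subgroup and are
    cyclic ([normal_stab_abelian]). Hence [A] is abelian and [K = S] is normal.
    This last case does occur: the partition into the graphs of the maps
    [x |-> x + c], for [G] and [H] both cyclic of the same prime order acting
    regularly, is of this kind. *)

(** * From invariant partitions to subgroups *)

(** The orbits of a normal subgroup [K] are permuted transitively by [A], as are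
    the parts of [Q]; sharing a single part thus forces equality. *)
Lemma normal_orbit_partition (aT : finGroupType) (T : finType)
    (A K : {group aT}) (S : {set T}) (to : {action aT &-> T})
    (Q : {set {set T}}) (x : T) :
    [transitive A, on S | to] -> invariant_partition A S to Q ->
    x \in S -> K <| A -> pblock Q x = orbit to K x ->
  Q = Defs.orbit_partition K S to.
Proof.
move=> trA [pQ aQ] Sx /andP[_ nKA] defB.
have [/eqP covQ tiQ Q0] := and3P pQ.
have orbQ y : y \in S -> orbit to K y \in Q.
  move=> Sy; have [a Aa ->] := atransP2 trA Sx Sy.
  rewrite -(normsP nKA a Aa) -setact_orbit -defB.
  by rewrite (acts_act aQ Aa) pblock_mem ?covQ.
apply/setP=> B; apply/idP/imsetP=> [QB | [y Sy ->]]; last exact: orbQ.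
have /set0Pn[y By]: B != set0 by apply: contraNneq Q0 => <-.
have Sy: y \in S by rewrite -covQ; apply/bigcupP; exists B.
exists y => //; rewrite -(def_pblock tiQ QB By).
by rewrite (def_pblock tiQ (orbQ y Sy)) ?orbit_refl.
Qed.

(** Parts are blocks of imprimitivity: an element of [A] moving [x] within its
    part must stabilise that part. *)
Lemma pblock_orbit (aT : finGroupType) (T : finType)
    (A : {group aT}) (S : {set T}) (to : {action aT &-> T})
    (Q : {set {set T}}) (x : T) :
    [transitive A, on S | to] -> invariant_partition A S to Q -> x \in S ->
  'C_A[x | to] \subset 'N_A(pblock Q x | to)
  /\ pblock Q x = orbit to 'N_A(pblock Q x | to) x.
Proof.
move=> trA [pQ aQ] Sx; have [/eqP covQ tiQ _] := and3P pQ.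
have QB: pblock Q x \in Q by rewrite pblock_mem ?covQ.
have Bx: x \in pblock Q x by rewrite mem_pblock covQ.
have stabB a: a \in A -> to x a \in pblock Q x -> a \in 'N_A(pblock Q x | to).
  move=> Aa Bxa; rewrite inE Aa -astab1_set; apply/astab1P=> /=.
  have QBa: to^* (pblock Q x) a \in Q by rewrite (acts_act aQ).
  by rewrite -(def_pblock tiQ QBa (mem_setact to a Bx)) (def_pblock tiQ QB Bxa).
split; first by apply/subsetP=> a /setIP[Aa /astab1P xa]; rewrite stabB ?xa.
apply/setP=> y; apply/idP/orbitP=> [By | [a /setIP[_ nBa] <-]]; last first.
  by rewrite (astabs_act _ nBa).
have Sy: y \in S by rewrite -covQ; apply/bigcupP; exists (pblock Q x).
by have [a Aa ya] := atransP2 trA Sx Sy; exists a; rewrite ?stabB -?ya.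
Qed.

(** * Maximal subgroups *)

(** All point stabilisers are conjugate, so a normal one fixes every point and
    is trivial by faithfulness. Then no subgroup lies strictly between [1] and
    [G], and any nontrivial element is a generator. *)
Lemma normal_stab_abelian (aT : finGroupType) (T : finType) (G : {group aT})
    (S : {set T}) (to : {action aT &-> T}) (x : T) :
    [faithful G, on S | to] -> [transitive G, on S | to] -> x \in S ->
    maximal_eq 'C_G[x | to] G -> 'C_G[x | to] <| G ->
  abelian G.
Proof.
move=> fG trG Sx /maximal_eqP[_ maxC] /andP[_ nCG].
have C1: 'C_G[x | to] = 1.
  apply/trivgP/subsetP=> c Cc; apply/set1P; have /setIP[Gc _] := Cc.
  apply: (faithfulP fG) => // y Sy; have [g Gg ->] := atransP2 trG Sx Sy.
  apply/astab1P; rewrite astab1_act mem_conjg.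
  have: c ^ g^-1 \in 'C_G[x | to] by rewrite memJ_norm // (subsetP nCG) ?groupV.
  by case/setIP.
have [-> | /trivgPn[g Gg g1]] := eqVneq (G : {set _}) 1; first exact: abelian1.
have [|| cycC | <-] := maxC <[g]>%G; rewrite /= ?C1 ?sub1G ?cycle_subG //.
    by case/eqP: g1; apply/set1gP; rewrite -C1 -cycC cycle_id.
exact: cycle_abelian.
Qed.

Lemma maximal_eq_setI (gT : finGroupType) (M G S : {group gT}) :
  maximal_eq M G -> M \subset S -> G :&: S = M \/ G :&: S = G.
Proof.
case/maximal_eqP=> sMG maxM sMS.
by apply: (maxM (G :&: S)%G); rewrite ?subsetIl // subsetI sMG.
Qed.

(** * Subgroups of a direct product *)

(** Goursat's argument. The projection of [S] to [G] is [G :&: S <*> H], which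
    contains [M], so it is [M] or [G]. In the first case the [G]-component of
    an element of [S] already lies in [S], and so does its [H]-component. In
    the second, [M = G :&: S] is normalised by [S] and centralised by [H],
    hence normalised by [G]. *)
Lemma dprod_subgroup_split (gT : finGroupType) (A G H M S : {group gT}) :
    G \x H = A -> maximal_eq M G -> S \subset A -> G :&: S = M ->
  M * (H :&: S) = S \/ M <| G.
Proof.
move=> dGH maxM sSA GSM; have sMG: M \subset G by rewrite -GSM subsetIl.
have [/andP[_ nGA] _] := dprod_normal2 dGH.
have [_ /= defA cGH _] := dprodP dGH.
have sMS: M \subset S by rewrite -GSM subsetIr.
have [|PM|PG] := @maximal_eq_setI _ M G (S <*> H) maxM.
- exact: subset_trans (joing_subl _ _).
- left; apply/eqP; rewrite eqEsubset mul_subG ?subsetIr //=.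
  apply/subsetP=> s Ss; have := subsetP sSA s Ss; rewrite -defA.
  case/mulsgP=> g h Gg Hh def_s.
  have Mg: g \in M.
    rewrite -PM inE Gg -(mulgK h g) -def_s groupM //.
      by rewrite (subsetP (joing_subl _ _)).
    by rewrite groupV (subsetP (joing_subr _ _)).
  rewrite def_s mem_mulg // inE Hh -(mulKg g h) -def_s groupM ?groupV //.
  exact: (subsetP sMS).
right; rewrite /normal sMG; have: G \subset S <*> H by rewrite -{1}PG subsetIr.
move/subset_trans; apply; rewrite join_subG -{1}GSM.
rewrite normsI ?normG ?(subset_trans sSA nGA) //=.
exact/cents_norm/(subset_trans cGH)/centS.
Qed.

(** The abelian hypotheses serve the case of a diagonal [S], one that projects
    onto both factors without containing either: it need not be normal in [A]
    when [A] is not abelian, as the diagonal of a square shows. *)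
Lemma dprod_normal_supplement (gT : finGroupType)
    (A G H M N S : {group gT}) :
    G \x H = A -> maximal_eq M G -> maximal_eq N H ->
    (M <| G -> abelian G) -> (N <| H -> abelian H) ->
    M * N \subset S -> S \subset A ->
  exists2 K : {group gT}, K <| A & M * N * K = S.
Proof.
move=> dGH maxM maxN cGG cHH sMNS sSA.
have [/maximal_eqP[sMG _] /maximal_eqP[sNH _]] := (maxM, maxN).
have [nsGA nsHA] := dprod_normal2 dGH.
have [_ /= defA cGH _] := dprodP dGH.
have cMN: commute (M : {set _}) (N : {set _}).
  apply/centC/(subset_trans sMG); rewrite centsC.
  exact: subset_trans cGH.
have sMS := subset_trans (mulG_subl _ _) sMNS.
have sNS := subset_trans (mulG_subr _ _) sMNS.
have [GSM | GSG] := maximal_eq_setI maxM sMS.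
  have [HSN | /setIidPl sHS] := maximal_eq_setI maxN sNS.
    have [MS | nsMG] := dprod_subgroup_split dGH maxM sSA GSM.
      by exists 1%G; rewrite ?normal1 // mulg1 -[RHS]MS HSN.
    have dHG: H \x G = A by rewrite dprodC.
    have [NS | nsNH] := dprod_subgroup_split dHG maxN sSA HSN.
      by exists 1%G; rewrite ?normal1 // mulg1 cMN -[RHS]NS GSM.
    (* Both factors are abelian, so the possibly diagonal [S] is normal. *)
    exists S; last by rewrite -mulgA !mulSGid.
    by rewrite -sub_abelian_normal // -defA abelianM cGG ?cHH.
  exists H => //; rewrite -mulgA (mulSGid sNH) -GSM setIC group_modr //.
  by rewrite defA (setIidPl sSA).
have sGS: G \subset S by rewrite -GSG subsetIr.
have defS: G * (H :&: S) = S by rewrite group_modl // defA (setIidPr sSA).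
have [HSN | HSH] := maximal_eq_setI maxN sNS.
  exists G; rewrite // cMN -mulgA (mulSGid sMG) -[RHS]defS HSN.
  exact/centC/(subset_trans sNH).
exists A; rewrite ?normal_refl // -mulgA !mulSGid ?(subset_trans _ sSA) //.
by rewrite -defS HSH defA.
Qed.

Lemma injm_maximal_eq (aT rT : finGroupType) (D : {group aT})
    (f : {morphism D >-> rT}) (M G : {group aT}) :
    'injm f -> M \subset D -> G \subset D ->
  maximal_eq (f @* M) (f @* G) = maximal_eq M G.
Proof.
move=> injf sMD sGD; congr (_ || _); last exact: injm_maximal.
by rewrite (inj_in_eq (injm_morphim_inj injf)).
Qed.

Lemma setX_normal_supplement (gT1 gT2 : finGroupType)
    (M G : {group gT1}) (N H : {group gT2}) (S : {group gT1 * gT2}) :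
    maximal_eq M G -> maximal_eq N H ->
    (M <| G -> abelian G) -> (N <| H -> abelian H) ->
    setX M N \subset S -> S \subset setX G H ->
  exists2 K : {group gT1 * gT2}, K <| setX G H & setX M N * K = S.
Proof.
move=> maxM maxN cGG cHH; rewrite -setX_prod -morphim_pairg1 -morphim_pair1g.
have [inj1 inj2] := (injm_pairg1 gT1 gT2, injm_pair1g gT1 gT2).
apply: (@dprod_normal_supplement _ (setX_group G H)
  (pairg1_morphism gT1 gT2 @* G) (pair1g_morphism gT1 gT2 @* H)).
- by rewrite /= morphim_pairg1 morphim_pair1g setX_dprod.
- by rewrite injm_maximal_eq ?subsetT.
- by rewrite injm_maximal_eq ?subsetT.
- by rewrite injm_normal ?injm_abelian ?subsetT.
- by rewrite injm_normal ?injm_abelian ?subsetT.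
Qed.

Theorem theorem2p7 (Gamma Delta : finType)
    (G : {group {perm Gamma}}) (H : {group {perm Delta}})
    (transG : [transitive G, on [set: Gamma] | 'P])
    (transH : [transitive H, on [set: Delta] | 'P])
    (primG : [primitive G, on [set: Gamma] | 'P])
    (primH : [primitive H, on [set: Delta] | 'P]) :
  preprimitive (setX_group G H) [set: Gamma * Delta] (pair_action 'P 'P).
Proof.
have [x0 _ _] := imsetP transG; have [y0 _ _] := imsetP transH.
have trGH: [transitive setX_group G H, on [set: Gamma * Delta] | pair_action 'P 'P].
  apply/imsetP; exists (x0, y0); rewrite ?inE //; apply/esym/setP=> -[x y].
  have [g Gg ->] := atransP2 transG (in_setT x0) (in_setT x).
  have [h Hh ->] := atransP2 transH (in_setT y0) (in_setT y).
  by rewrite inE; apply/orbitP; exists (g, h); rewrite // in_setX Gg.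
split=> // Q invQ.
have maxM := primG; rewrite (trans_prim_astab (in_setT x0) transG) in maxM.
have maxN := primH; rewrite (trans_prim_astab (in_setT y0) transH) in maxN.
have [sCS defB] := pblock_orbit trGH invQ (in_setT (x0, y0)).
have defC: setX 'C_G[x0 | 'P] 'C_H[y0 | 'P]
         = 'C_(setX G H)[(x0, y0) | pair_action 'P 'P].
  apply/setP=> -[g h]; rewrite in_setX 3!in_setI in_setX andbACA; congr (_ && _).
  apply/andP/astab1P=> [[/astab1P xg /astab1P yh] | [xg yh]].
    by congr (_, _).
  by split; apply/astab1P.
have [|||K nsK defS] := setX_normal_supplement maxM maxN _ _ _
    (subsetIl _ _ : 'N_(setX G H)(pblock Q (x0, y0) | pair_action 'P 'P) \subset _).
- exact: normal_stab_abelian (perm_faithful G) transG (in_setT x0) maxM.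
- exact: normal_stab_abelian (perm_faithful H) transH (in_setT y0) maxN.
- by rewrite defC.
have [sKA _] := andP nsK; exists K => //.
apply: (normal_orbit_partition trGH invQ (in_setT (x0, y0)) nsK).
rewrite {}defB -[in LHS]defS defC; apply/setP=> z.
apply/orbitP/orbitP=> [[_ /mulsgP[c k /setIP[_ /astab1P xc] Kk ->] <-] | [k Kk <-]].
  by exists k; rewrite // actM xc.
by exists k; rewrite // -[k]mul1g mem_mulg.
Qed.
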